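(* Let $0 \le k \le d$ be integers, let $\omega \in \mathcal{S}_k$ and let $F = \omega\, x_0^{d-k} \in \mathcal{S}_d$. Then $$(\omega^{d,x_0})_{\rm dp} = f_{x_0} \qquad\text{and}\qquad \mathrm{Ann}^{\star}\big(\omega^{d,x_0}\,\mathbf{e}^{x_0}\big) = \mathrm{Ann}^{\lrcorner}(f_{x_0}),$$ the second being an equality of ideals of $\mathcal{R}' = \Bbbk[y_1,\dots,y_n]$.
   Context: Let $n \ge 1$ be an integer and $\Bbbk$ a field whose characteristic is zero or strictly larger than $d$. Let $\mathcal{S} = \bigoplus_{d}\mathcal{S}_d = \Bbbk[x_0,\dots,x_n]$ with its standard grading, $\mathcal{S}' = \Bbbk[x_1,\dots,x_n]$ and $\mathcal{R}' = \Bbbk[y_1,\dots,y_n]$. Divided powers: for a polynomial $F = \sum_\alpha F_\alpha x^\alpha$ (in $\mathcal{S}$ or $\mathcal{S}'$), set $F_{\rm dp} = \sum_\alpha \alpha!\,F_\alpha x^\alpha$, where $\alpha! = \prod_i \alpha_i!$. Contraction: $\mathcal{R}'$ acts on $\mathcal{S}'$ $\Bbbk$-bilinearly by $y^\beta \lrcorner x^\alpha = x^{\alpha-\beta}$ if $\alpha \ge \beta$ componentwise, and $0$ otherwise. For $f \in \mathcal{S}'$, $\mathrm{Ann}^{\lrcorner}(f) = \{g \in \mathcal{R}' : g \lrcorner f = 0\}$. The polynomial $f_{x_0} \in \mathcal{S}'$ is the de-homogenization of $F_{\rm dp}$ at $x_0 = 1$, i.e. $f_{x_0} = F_{\rm dp}(1,x_1,\dots,x_n)$.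 The polynomial $\omega^{d,x_0}$: write uniquely $\omega = \sum_{j=0}^k w_j\, x_0^{k-j}$ with $w_j \in \mathcal{S}'_j$ homogeneous of degree $j$; then $\omega^{d,x_0} = \sum_{j=0}^k (d-j)!\, w_j \in \mathcal{S}'_{\le k}$. Functionals and $\star$-action: a power series in $x_1,\dots,x_n$ is regarded as a linear functional on $\mathcal{R}'$ by letting $x^\alpha$ represent the dual element of $y^\alpha/\alpha!$, i.e. $x^\alpha$ sends $y^\alpha$ to $\alpha!$ and $y^\beta$ to $0$ for $\beta\neq\alpha$. For $g \in \mathcal{R}'$ and a functional $\varphi$ on $\mathcal{R}'$, $g \star \varphi$ is the functional $p \mapsto \varphi(gp)$, and $\mathrm{Ann}^{\star}(\varphi) = \{g \in \mathcal{R}' : g \star \varphi = 0\}$. The series $\mathbf{e}^{x_0}$ is the de-homogenization at $x_0=1$ of the exponential series $\sum_{j \ge 0} x_0^j/j!$; it is a nonzero constant scalar (formally $e$), and it represents, up to this nonzero scalar, the evaluation of polynomials of $\mathcal{R}'$ at the origin. This scalar is irrelevant for annihilators and may be normalized to $1$. Thus $\omega^{d,x_0}\mathbf{e}^{x_0}$ is, up to a nonzero scalar, the functional on $\mathcal{R}'$ represented by the polynomial $\omega^{d,x_0}$, i.e. the functional sending $p$ to the value at the origin of the polynomial obtained by applying to $p$ the differential operator $\omega^{d,x_0}(\partial_{y_1},\dots,\partial_{y_n})$. *)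

(* Defs.v *)
From HB Require Import structures.
From mathcomp Require Import all_boot all_order all_algebra.
From mathcomp Require Import ssrcomplements mpoly.

Set Implicit Arguments.
Unset Strict Implicit.
Unset Printing Implicit Defensive.

Import GRing.Theory.

Local Open Scope ring_scope.

(* The ring S = K[x_0, ..., x_n] is {mpoly K[n.+1]}, with x_0 = 'X_ord0, and
   both S' = K[x_1, ..., x_n] and R' = K[y_1, ..., y_n] are {mpoly K[n]}: the
   variable 'X_i, for i : 'I_n, stands for x_(i+1), resp. y_(i+1). *)

Definition mfact (n : nat) (m : 'X_{1..n}) : nat := (\prod_(i < n) (m i)`!)%N.

Section DividedPowersAndContraction.

Context {K : fieldType} {n : nat}.

Definition dp (F : {mpoly K[n]}) : {mpoly K[n]} :=
  \sum_(a <- msupp F) ((mfact a)%:R * F@_a) *: 'X_[a].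

Definition contract_mon (b a : 'X_{1..n}) : {mpoly K[n]} :=
  if (b <= a)%MM then 'X_[(a - b)%MM] else 0.

Definition contract (g f : {mpoly K[n]}) : {mpoly K[n]} :=
  \sum_(b <- msupp g) \sum_(a <- msupp f) (g@_b * f@_a) *: contract_mon b a.

Definition Ann_contract (f g : {mpoly K[n]}) : Prop := contract g f = 0.

End DividedPowersAndContraction.

Section Dehomogenization.

Context {K : fieldType} {n : nat}.

Definition dehomog (F : {mpoly K[n.+1]}) : {mpoly K[n]} :=
  F \mPo [tuple of (1 : {mpoly K[n]}) :: [tuple 'X_i | i < n]].

(* The inclusion of S' in S. *)
Definition incl (p : {mpoly K[n]}) : {mpoly K[n.+1]} :=
  p \mPo [tuple 'X_(lift ord0 i) | i < n].

Definition f_x0 (F : {mpoly K[n.+1]}) : {mpoly K[n]} := dehomog (dp F).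

Definition mtail (m : 'X_{1..n.+1}) : 'X_{1..n} :=
  [multinom m (lift ord0 i) | i < n].

(* The w_j in omega = \sum_(j <= k) w_j x_0^(k-j): the terms of omega divisible
   by exactly x_0^(k-j), with that power removed.  See x0_coef_homog,
   x0_coef_sum and x0_coef_uniq. *)
Definition x0_coef (k : nat) (omega : {mpoly K[n.+1]}) (j : nat) :
    {mpoly K[n]} :=
  \sum_(m <- msupp omega | m ord0 == (k - j)%N) omega@_m *: 'X_[mtail m].

Definition mcons (a : nat) (m : 'X_{1..n}) : 'X_{1..n.+1} :=
  [multinom oapp m a (unlift ord0 i) | i < n.+1].

Lemma mconsS a m i : mcons a m (lift ord0 i) = m i.
Proof. by rewrite mnmE liftK. Qed.

Lemma mcons0 a m : mcons a m ord0 = a.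
Proof. by rewrite mnmE unlift_none. Qed.

Lemma mconsK a m : mtail (mcons a m) = m.
Proof. by apply/mnmP=> i; rewrite mnmE mconsS. Qed.

Lemma mcons_tail (m : 'X_{1..n.+1}) : mcons (m ord0) (mtail m) = m.
Proof.
apply/mnmP=> i; case: (unliftP ord0 i) => [j ->|->]; last exact: mcons0.
by rewrite mconsS mnmE.
Qed.

Lemma mdeg_tail (m : 'X_{1..n.+1}) : mdeg m = (m ord0 + mdeg (mtail m))%N.
Proof.
by rewrite !mdegE big_ord_recl; congr addn; apply: eq_bigr => i _; rewrite mnmE.
Qed.

Lemma mcoeff_x0_coef k omega j m :
  (x0_coef k omega j)@_m = omega@_(mcons (k - j) m).
Proof.
rewrite /x0_coef raddf_sum big_mkcond /= (eq_bigr
  (fun a => (omega@_(mcons (k - j) m)) * (a == mcons (k - j) m)%:R)); last first.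
  move=> a _; rewrite mcoeffZ mcoeffX; case: (a =P mcons _ _) => [->|ne].
    by rewrite mcons0 mconsK !eqxx.
  case: eqP => [a0|_]; last by rewrite mulr0.
  case: eqP => [e|_]; last by rewrite !mulr0.
  by case: ne; rewrite -[a]mcons_tail a0 e.
case: (boolP (mcons (k - j) m \in msupp omega)) => [inm|]; last first.
  by move/memN_msupp_eq0 ->; rewrite big1 // => a _; rewrite mul0r.
rewrite (bigD1_seq _ inm) ?msupp_uniq //= eqxx mulr1.
by rewrite big1 ?addr0 // => a /negPf ->; rewrite mulr0.
Qed.

Lemma inclX (m : 'X_{1..n}) : incl 'X_[m] = 'X_[mcons 0 m].
Proof.
rewrite /incl comp_mpolyX [RHS]mpolyXE_id big_ord_recl mcons0 expr0 mul1r.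
by apply: eq_bigr => i _; rewrite tnth_mktuple mconsS.
Qed.

Lemma mcoeff_inclM (p : {mpoly K[n]}) i (m : 'X_{1..n.+1}) :
  (incl p * 'X_ord0 ^+ i)@_m = if m ord0 == i then p@_(mtail m) else 0.
Proof.
have -> : incl p * 'X_ord0 ^+ i =
    \sum_(a <- msupp p) p@_a *: 'X_[mcons i a].
  rewrite /incl {1}[p]mpolyE raddf_sum /= mulr_suml; apply: eq_bigr => a _.
  rewrite linearZ /= -scalerAl -/(incl _) inclX mpolyXn -mpolyXD.
  congr (_ *: 'X_[_]); apply/mnmP=> l; rewrite mnmDE mulmnE mnm1E.
  case: (unliftP ord0 l) => [l' ->|->]; last by rewrite !mcons0 eqxx mul1n.
  by rewrite !mconsS mul0n addn0.
rewrite raddf_sum /=; case: eqP => [mi|ne]; last first.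
  rewrite big1 // => a _; rewrite mcoeffZ mcoeffX.
  by case: eqP => [e|_]; rewrite ?mulr0 //; case: ne; rewrite -e mcons0.
rewrite [in RHS](mpolyE p) raddf_sum /=; apply: eq_bigr => a _.
rewrite !mcoeffZ !mcoeffX; congr (_ * _%:R); congr nat_of_bool.
apply/eqP/eqP => [<-|->]; first by rewrite mconsK.
by rewrite -mi mcons_tail.
Qed.

Lemma x0_coef_homog k omega j :
  omega \is k.-homog -> (j <= k)%N -> x0_coef k omega j \is j.-homog.
Proof.
move=> ho jk; apply/dhomogP=> m.
rewrite mcoeff_msupp mcoeff_x0_coef -mcoeff_msupp => /(dhomog_mf ho) /=.
rewrite mdeg_tail mcons0 mconsK => e; apply/eqP.
by rewrite -(eqn_add2l (k - j)) e subnK.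
Qed.

Lemma x0_coef_sum k omega :
  omega \is k.-homog ->
  omega = \sum_(j < k.+1) incl (x0_coef k omega j) * 'X_ord0 ^+ (k - j).
Proof.
move=> ho; apply/mpolyP=> m; rewrite raddf_sum /=.
rewrite (eq_bigr (fun j : 'I_k.+1 =>
    if m ord0 == (k - j)%N then omega@_m else 0)); last first.
  move=> j _; rewrite mcoeff_inclM; case: eqP => // e.
  by rewrite mcoeff_x0_coef -e mcons_tail.
case: (boolP (m \in msupp omega)) => [inm|]; last first.
  by move/memN_msupp_eq0 ->; rewrite big1 // => a _; rewrite if_same.
have m0k : (m ord0 <= k)%N.
  by rewrite -(dhomog_mf ho inm) /= mdeg_tail leq_addr.
have lt : (k - m ord0 < k.+1)%N by rewrite ltnS leq_subr.
rewrite (bigD1 (Ordinal lt)) //= subKn // eqxx big1 ?addr0 // => j nej.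
case: eqP => // e; case/eqP: nej; apply/val_inj => /=.
by rewrite e subKn // -ltnS.
Qed.

Lemma x0_coef_uniq k omega (w : nat -> {mpoly K[n]}) :
  omega = \sum_(j < k.+1) incl (w j) * 'X_ord0 ^+ (k - j) ->
  forall j, (j <= k)%N -> x0_coef k omega j = w j.
Proof.
move=> -> j jk; apply/mpolyP=> m; rewrite mcoeff_x0_coef raddf_sum /=.
have lt : (j < k.+1)%N by rewrite ltnS.
rewrite (bigD1 (Ordinal lt)) //= mcoeff_inclM mcons0 eqxx mconsK.
rewrite big1 ?addr0 // => i nei; rewrite mcoeff_inclM mcons0.
case: eqP => // e; case/eqP: nei; apply/val_inj => /=.
by rewrite -(subKn jk) e subKn // -ltnS.
Qed.

Definition omega_dx0 (d k : nat) (omega : {mpoly K[n.+1]}) : {mpoly K[n]} :=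
  \sum_(j < k.+1) ((d - j)`!)%:R *: x0_coef k omega j.

End Dehomogenization.

Section Functionals.

Context {K : fieldType} {n : nat}.

(* A power series in x_1, ..., x_n, given by its coefficients. *)
Definition mseries : Type := 'X_{1..n} -> K.

Definition series_of_mpoly (p : {mpoly K[n]}) : mseries := fun m => p@_m.

(* Same convolution formula as mcoeffM. *)
Definition series_mul (s t : mseries) : mseries := fun m =>
  \sum_(h : 'X_{1..n < (mdeg m).+1, (mdeg m).+1} | m == (h.1 + h.2)%MM)
    s h.1 * t h.2.

(* The de-homogenization at x_0 = 1 of \sum_j x_0^j / j! has no variable left:
   it is a constant series, whose constant term (formally e) does not make
   sense in K and is only known to be a nonzero scalar; it is a parameter. *)
Definition exp_x0 (e : K) : mseries := fun m => if m == 0%MM then e else 0.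

(* x^a sends y^a to a! and the other monomials to 0. *)
Definition functional (s : mseries) (p : {mpoly K[n]}) : K :=
  \sum_(a <- msupp p) p@_a * (s a * (mfact a)%:R).

Lemma functional_is_linear (s : mseries) : scalar (functional s).
Proof.
move=> c p q; have E (r : {mpoly K[n]}) b : (msize r <= b)%N -> functional s r =
    \sum_(a : 'X_{1..n < b}) r@_a * (s a * (mfact a)%:R).
  move=> rb; pose I : subFinType _ := 'X_{1..n < b}.
  rewrite /functional (big_mksub I) ?msupp_uniq //=; first last.
    by move=> x /msize_mdeg_lt /leq_trans; apply.
  by rewrite big_rmcond //= => i /memN_msupp_eq0 ->; rewrite mul0r.
pose b := maxn (msize (c *: p + q)) (maxn (msize p) (msize q)).
have le (r : {mpoly K[n]}) : r \in [:: c *: p + q; p; q] -> (msize r <= b)%N.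
  by rewrite !inE /b => /or3P[] /eqP ->; rewrite !leq_max leqnn ?orbT.
rewrite (E _ b (le p _)) ?(E _ b (le q _)) ?(E _ b (le (c *: p + q) _));
  rewrite ?inE ?eqxx ?orbT //.
rewrite mulr_sumr -big_split /=.
by apply: eq_bigr => a _; rewrite mcoeffD mcoeffZ mulrDl -mulrA.
Qed.

HB.instance Definition _ (s : mseries) :=
  GRing.isLinear.Build K {mpoly K[n]} K _ (functional s)
    (functional_is_linear s).

Definition star (g : {mpoly K[n]}) (phi : {scalar {mpoly K[n]}}) :
    {mpoly K[n]} -> K :=
  fun p => phi (g * p).

Definition Ann_star (phi : {scalar {mpoly K[n]}}) (g : {mpoly K[n]}) : Prop :=
  forall p, star g phi p = 0.

End Functionals.

Arguments mseries : clear implicits.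

(* Main.v *)
(* Both identities are read off coefficients.  A monomial x^m of degree j <= k
   arises in f_x0 only from the monomial x_0^(d-j) x^m of F, whose divided-power
   factor (d-j)! m! is the factor (d-j)! of omega^{d,x_0} times the
   divided-power factor m!.  Hence the functional of omega^{d,x_0} sends y^a to
   the coefficient of x^a in f_x0 (up to the scalar e), and the coefficient of
   x^c in the contraction of f_x0 by g is the value of the functional at
   g y^c. *)
Require Import Defs.
From mathcomp Require Import all_boot all_order all_algebra.
From mathcomp Require Import mpoly.

Set Implicit Arguments.
Unset Strict Implicit.
Unset Printing Implicit Defensive.

Import GRing.Theory.

Local Open Scope ring_scope.

(** Collapses a sum over a support to one term, even for [m] outside the support, where both sides
    vanish. *)
Lemma sum_msupp_delta (K : fieldType) (n : nat) (p : {mpoly K[n]})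
    (m : 'X_{1..n}) (c : 'X_{1..n} -> K) :
  \sum_(a <- msupp p) p@_a * c a * (a == m)%:R = p@_m * c m.
Proof.
have [m_in|/memN_msupp_eq0 pm0] := boolP (m \in msupp p).
  rewrite (bigD1_seq _ m_in) ?msupp_uniq //= eqxx mulr1 big1 ?addr0 //.
  by move=> a /negPf ->; rewrite mulr0.
rewrite pm0 mul0r big1 // => a _.
by case: eqP => [->|_]; rewrite ?pm0 ?mul0r ?mulr0.
Qed.

Lemma mcoeff_dp (K : fieldType) (n : nat) (F : {mpoly K[n]}) m :
  (dp F)@_m = (mfact m)%:R * F@_m.
Proof.
rewrite /dp raddf_sum /= mulrC -(sum_msupp_delta F m (fun a => (mfact a)%:R)).
by apply: eq_bigr => a _; rewrite mcoeffZ mcoeffX [_%:R * F@_a]mulrC.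
Qed.

Lemma mfact_mcons (n a : nat) (m : 'X_{1..n}) :
  mfact (mcons a m) = (a`! * mfact m)%N.
Proof.
rewrite /mfact big_ord_recl mcons0; congr muln.
by apply: eq_bigr => i _; rewrite mconsS.
Qed.

Lemma dehomogX (K : fieldType) (n : nat) (m : 'X_{1..n.+1}) :
  dehomog 'X_[m] = 'X_[mtail m] :> {mpoly K[n]}.
Proof.
rewrite /dehomog comp_mpolyX big_ord_recl [RHS]mpolyXE_id.
rewrite (tnth_nth 0) /= expr1n mul1r; apply: eq_bigr => i _.
by rewrite tnthS tnth_mktuple mnmE.
Qed.

(* On homogeneous polynomials dehomogenization loses no information: the degree
   determines the exponent of x_0. *)
Lemma mcoeff_dehomog (K : fieldType) (n d : nat) (F : {mpoly K[n.+1]}) m :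
  F \is d.-homog ->
  (dehomog F)@_m = if (mdeg m <= d)%N then F@_(mcons (d - mdeg m) m) else 0.
Proof.
move=> hF; rewrite /dehomog comp_mpolyEX raddf_sum /=.
have E a : a \in msupp F -> (mtail a == m) =
    (mdeg m <= d)%N && (a == mcons (d - mdeg m) m).
  move=> /(dhomog_mf hF) /= da.
  apply/eqP/andP => [<-|[_ /eqP ->]]; last exact: mconsK.
  by rewrite -da mdeg_tail leq_addl addnK mcons_tail.
(* The factor [1] is the constant weight that puts the sum in the shape of [sum_msupp_delta]. *)
rewrite (eq_big_seq (fun a => F@_a * 1 *
    ((mdeg m <= d)%N && (a == mcons (d - mdeg m) m))%:R)); last first.
  move=> a /E a_m; rewrite mcoeffZ -/(dehomog _) dehomogX mcoeffX.
  by rewrite a_m mulr1.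
case: ifP => _ /=; first by rewrite (sum_msupp_delta _ _ (fun=> 1)) mulr1.
by rewrite big1 // => a _; rewrite mulr0.
Qed.

(** Scaling coefficients by factorials can only shrink the support. *)
Lemma dp_homog (K : fieldType) (n d : nat) (F : {mpoly K[n]}) :
  F \is d.-homog -> dp F \is d.-homog.
Proof.
move=> hF; apply/dhomogP => m; rewrite mcoeff_msupp mcoeff_dp mulf_eq0.
by case/norP => _; rewrite -mcoeff_msupp => /(dhomog_mf hF).
Qed.

(** Each [x0_coef k omega j] is homogeneous of degree [j], so only the summand with [j = mdeg m] can
    contribute. *)
Lemma mcoeff_omega_dx0 (K : fieldType) (n d k : nat) (omega : {mpoly K[n.+1]})
    m : omega \is k.-homog ->
  (omega_dx0 d k omega)@_m =
    if (mdeg m <= k)%N then ((d - mdeg m)`!)%:R * omega@_(mcons (k - mdeg m) m)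
    else 0.
Proof.
move=> ho; rewrite /omega_dx0 raddf_sum /=.
have other (j : 'I_k.+1) : (j : nat) != mdeg m ->
    (((d - j)`!)%:R *: x0_coef k omega j)@_m = 0.
  have jk : (j <= k)%N by rewrite -ltnS.
  move=> ne; rewrite mcoeffZ (dhomog_nemf_coeff (x0_coef_homog ho jk)) ?mulr0 //.
  by rewrite eq_sym.
case: leqP => [mk|km]; last first.
  by rewrite big1 // => j _; apply: other; rewrite neq_ltn (leq_trans _ km).
rewrite (bigD1 (Ordinal (mk : (mdeg m < k.+1)%N))) //= mcoeffZ mcoeff_x0_coef.
by rewrite big1 ?addr0 // => j ne; apply: other.
Qed.

Lemma mcoeffMX0n (K : fieldType) (n i l : nat) (p : {mpoly K[n.+1]}) m :
  (p * 'X_ord0 ^+ i)@_(mcons l m) =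
    if (i <= l)%N then p@_(mcons (l - i) m) else 0.
Proof.
rewrite mpolyXn; case: leqP => [il|li].
  have -> : mcons l m = (U_(ord0) *+ i + mcons (l - i) m)%MM.
    apply/mnmP => h; rewrite mnmDE mulmnE mnm1E.
    case: (unliftP ord0 h) => [j ->|->]; first by rewrite !mconsS mul0n.
    by rewrite !mcons0 eqxx mul1n subnKC.
  exact: mcoeffMX.
(* Here [l < i], while every monomial of the product has exponent at least [i] in ['X_ord0]. *)
rewrite [p]mpolyE mulr_suml raddf_sum big1 // => a _ /=.
rewrite -scalerAl -mpolyXD mcoeffZ mcoeffX.
case: eqP => [/mnmP/(_ ord0)|_]; last by rewrite mulr0.
rewrite mnmDE mulmnE mnm1E mcons0 eqxx mul1n => al.
by rewrite -al ltnNge leq_addl in li.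
Qed.

Lemma dp_omega_dx0 (K : fieldType) (n d k : nat) (omega : {mpoly K[n.+1]}) :
  (k <= d)%N -> omega \is k.-homog ->
  dp (omega_dx0 d k omega) = f_x0 (omega * 'X_ord0 ^+ (d - k)).
Proof.
move=> kd ho; have hF : omega * 'X_ord0 ^+ (d - k) \is d.-homog.
  rewrite -{2}(subnKC kd) mpolyXn; apply: dhomogM ho _.
  by rewrite dhomogX /= mdegMn mdeg1 mul1n.
apply/mpolyP => m; rewrite mcoeff_dp mcoeff_omega_dx0 //.
rewrite (mcoeff_dehomog _ (dp_homog hF)) mcoeff_dp mfact_mcons mcoeffMX0n.
have [mk|km] := leqP (mdeg m) k.
  by rewrite (leq_trans mk kd) leq_sub2l // subnAC subKn // natrM mulrCA mulrA.
(* In degrees above [k] but at most [d], the exponent [d - mdeg m] is too small for a multiple of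
   ['X_ord0 ^+ (d - k)]. *)
by rewrite mulr0; case: leqP => // md; rewrite leq_sub2lE // leqNgt km mulr0.
Qed.

(** Contraction by the monomial of exponent [b] reaches exponent [c] from [b + c] only. *)
Lemma mcoeff_contract (K : fieldType) (n : nat) (g f : {mpoly K[n]}) c :
  (contract g f)@_c = \sum_(b <- msupp g) g@_b * f@_(b + c)%MM.
Proof.
rewrite /contract raddf_sum; apply: eq_bigr => b _ /=.
rewrite raddf_sum /= -[f@__]mulr1 -(sum_msupp_delta _ _ (fun=> 1)) mulr_sumr.
apply: eq_bigr => a _; rewrite mcoeffZ mulr1 -mulrA; congr (_ * (_ * _)).
rewrite /contract_mon; case: ifP => [ba|nba].
  by rewrite mcoeffX -(inj_eq (@addmI _ b)) addmC submK.
by rewrite mcoeff0; case: eqP => // ae; rewrite ae lem_addr in nba.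
Qed.

Lemma functionalX (K : fieldType) (n : nat) (s : mseries K n) a :
  functional s 'X_[a] = s a * (mfact a)%:R.
Proof. by rewrite /functional msuppX big_seq1 mcoeffX eqxx mul1r. Qed.

(** In the convolution only the splitting [m = m + 0] survives. *)
Lemma series_mul_exp_x0 (K : fieldType) (n : nat) (s : mseries K n) (e : K) m :
  series_mul s (exp_x0 e) m = s m * e.
Proof.
have m_lt : (mdeg m < (mdeg m).+1)%N by [].
have z_lt : (mdeg (0%MM : 'X_{1..n}) < (mdeg m).+1)%N by rewrite mdeg0.
rewrite /series_mul (bigD1 (BMultinom m_lt, BMultinom z_lt)) /= ?addm0 //.
rewrite /exp_x0 eqxx big1 ?addr0 // => -[h1 h2] /= /andP [/eqP mE ne].
case: eqP => [h20|]; last by rewrite mulr0.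
case/eqP: ne; congr pair; apply: val_inj => //=.
by rewrite [RHS]mE h20 addm0.
Qed.

Lemma Ann_starP (K : fieldType) (n : nat) (s : mseries K n) (f g : {mpoly K[n]})
    (e : K) :
  e != 0 -> (forall a, s a * (mfact a)%:R = e * f@_a) ->
  Ann_star (functional s) g <-> Ann_contract f g.
Proof.
move=> e0 sf.
have starX c : star g (functional s) 'X_[c] = e * (contract g f)@_c.
  rewrite /star {1}[g]mpolyE mulr_suml raddf_sum mcoeff_contract mulr_sumr /=.
  apply: eq_bigr => b _.
  by rewrite -scalerAl -mpolyXD linearZ /= functionalX sf mulrCA.
split=> [gs|gf p].
  apply/mpolyP => c; rewrite mcoeff0; apply: (mulfI e0).
  by rewrite -starX gs mulr0.
(* By linearity it is enough to test on monomials, where [starX] applies. *)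
rewrite /star [p]mpolyE mulr_sumr raddf_sum big1 //= => c _.
rewrite -scalerAr linearZ /= -[functional _ _]/(star g (functional s) 'X_[c]).
by rewrite starX gf mcoeff0 !mulr0.
Qed.

Theorem proposition2p4 (K : fieldType) (n d k : nat)
    (omega : {mpoly K[n.+1]}) (e : K) :
  (1 <= n)%N ->
  ([pchar K] =i pred0 \/ exists2 p : nat, p \in [pchar K] & (d < p)%N) ->
  (k <= d)%N ->
  omega \is k.-homog ->
  e != 0 ->
  let F := omega * 'X_ord0 ^+ (d - k) in
  let omega' := omega_dx0 d k omega in
  dp omega' = f_x0 F /\
  (forall g : {mpoly K[n]},
     Ann_star (functional (series_mul (series_of_mpoly omega') (exp_x0 e))) g
       <-> Ann_contract (f_x0 F) g).
Proof.
move=> _ _ kd ho e0 F omega'.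
have dpE : dp omega' = f_x0 F by exact: dp_omega_dx0.
(* The factor [mfact a] from [functional] turns the coefficient of [omega'] into that of
   [dp omega'], hence of [f_x0 F]. *)
split=> // g; apply: Ann_starP e0 _ => a.
rewrite series_mul_exp_x0 -dpE mcoeff_dp /series_of_mpoly.
by rewrite mulrAC mulrC [_%:R * _]mulrC.
Qed.
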